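(* Let $d\geq 2$ be a natural number and let $f_d:\mathbb R^d\to\mathbb R$ be the polynomial $$f_d(x_1,\ldots,x_d):=\prod_{1\leq i<j\leq d}(x_i^2-x_j^2).$$ Then $\Delta f_d(x)=0$ for all $x\in\mathbb R^d$, where $\Delta=\sum_{k=1}^d \partial^2/\partial x_k^2$ is the Laplacian. *)

(* Defs.v *)
From mathcomp Require Import all_boot all_order all_algebra.
From mathcomp Require Import boolp classical_sets reals topology normedtype derive.

Set Implicit Arguments.
Unset Strict Implicit.
Unset Printing Implicit Defensive.

Import Order.TTheory GRing.Theory Num.Theory.
Import numFieldNormedType.Exports.

Local Open Scope ring_scope.

Definition fd (R : realType) (d : nat) (x : 'rV[R]_d) : R :=
  \prod_(i < d) \prod_(j < d | (i < j)%N) (x 0 i ^+ 2 - x 0 j ^+ 2).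

(* ['D_v g] is a total operator, meaningful only where [g] is derivable along
   [v]; for a polynomial function such as [fd] all iterated directional
   derivatives exist.  The vectors [delta_mx 0 k] form the standard basis. *)
Definition laplacian (R : realType) (d : nat) (f : 'rV[R]_d -> R)
    (x : 'rV[R]_d) : R :=
  \sum_(k < d) 'D_(delta_mx 0 k) ('D_(delta_mx 0 k) f) x.

(* Main.v *)
Require Import Defs.
From mathcomp Require Import all_boot all_order all_algebra.
From mathcomp Require Import boolp classical_sets reals topology normedtype derive.

Import GRing.Theory.
Import numFieldNormedType.Exports.

Local Open Scope ring_scope.

(* [f_d] is the Vandermonde determinant in the variables
   [- x_j ^ 2].  Differentiating twice in [x_k] only affects column [k], and
   turns its [i]-th entry into a multiple, with a factor depending on [i] only,
   of its [(i - 1)]-st entry.  Summing the cofactor expansions over [k], the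
   [i]-th row contributes a determinant with two equal rows, which is zero. *)

Lemma cofactor_eq_col' (R : pzRingType) (n : nat) (A B : 'M[R]_n)
    (i j : 'I_n) :
  (forall k l, l != j -> A k l = B k l) -> cofactor A i j = cofactor B i j.
Proof.
move=> AB; congr (_ * \det _); apply/matrixP => k l.
by rewrite !mxE AB // eq_sym neq_lift.
Qed.

(** Since [p] is invariant along the [k]-th axis, the difference quotients of [f] at [x] in that
    direction are those of the single polynomial [p x] at [x 0 k]. *)
Lemma derive_delta_horner (R : realFieldType) (d : nat) (k : 'I_d)
    (f : 'rV[R]_d -> R) (p : 'rV[R]_d -> {poly R}) :
  (forall x, f x = (p x).[x 0 k]) ->
  (forall h x, p (h *: delta_mx 0 k + x) = p x) ->
  forall x, 'D_(delta_mx 0 k) f x = (p x)^`().[x 0 k].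
Proof.
move=> fE pE x.
rewrite -(@derive_val _ _ _ _ _ _ _ (is_derive_poly (p x) (x 0 k))).
rewrite /derive; set F := (F in lim (F @ _)%classic).
set G := (G in _ = lim (G @ _)%classic).
suff -> : F = G by []; apply/funext => h; rewrite {}/F {}/G /=.
by rewrite !fE pE !mxE !eqxx.
Qed.

Lemma derivn2_expNX2 (R : comNzRingType) (n : nat) :
  ((- 'X^2) ^+ n.+1)^`(2) =
    - ((- 'X^2) ^+ n *+ (n.*2.+2 * n.*2.+1)) :> {poly R}.
Proof.
have XE m : (- 'X^2) ^+ m = (-1) ^+ m *: 'X^(m.*2) :> {poly R}.
  by rewrite -scaleN1r exprZn -exprM mul2n.
rewrite !XE derivnZ derivnXn doubleS -addn2 addnK addn2 exprS mulN1r scaleNr.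
by rewrite ffactnS ffactn1 scalerMnr.
Qed.

(** With nodes [- x 0 j ^+ 2], the Vandermonde factor (node [j] minus node [i]) has the orientation
    used in [fd], so no global sign appears. *)
Lemma fd_det_Vandermonde (R : realType) (d : nat) (x : 'rV[R]_d) :
  fd x = \det (Vandermonde d (\row_j - x 0 j ^+ 2)).
Proof.
rewrite det_Vandermonde; apply: eq_bigr => i _; apply: eq_bigr => j _.
by rewrite !mxE opprK addrC.
Qed.

Theorem lemma1 (R : realType) (d : nat) (hd : (2 <= d)%N) (x : 'rV[R]_d) :
  laplacian (@fd R d) x = 0.
Proof.
pose V (y : 'rV[R]_d) := Vandermonde d (\row_j - y 0 j ^+ 2).
(* Cofactor expansion of the determinant along column [k], with [y 0 k] replaced by the
   indeterminate. *)
pose p k y : {poly R} := \sum_i cofactor (V y) i k *: (- 'X^2) ^+ i.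
have pE k h y : p k (h *: delta_mx 0 k + y) = p k y.
  apply: eq_bigr => i _; congr (_ *: _); apply: cofactor_eq_col' => a l lk.
  by rewrite !mxE (negPf lk) andbF mulr0 add0r.
have fdp k y : fd y = (p k y).[y 0 k].
  rewrite fd_det_Vandermonde (expand_det_col _ k) horner_sum; apply: eq_bigr => i _.
  by rewrite hornerZ horner_exp hornerN hornerXn !mxE mulrC.
have D2E k : 'D_(delta_mx 0 k) ('D_(delta_mx 0 k) (@fd R d)) x =
    \sum_i cofactor (V x) i k * (((- 'X^2) ^+ i)^`(2)).[x 0 k].
  transitivity (p k x)^`(2).[x 0 k]; last first.
    rewrite linear_sum horner_sum; apply: eq_bigr => i _.
    by rewrite -hornerZ -derivnZ.
  rewrite (@derive_delta_horner _ _ _ _ (fun y => (p k y)^`())) //.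
    by move=> y; apply: derive_delta_horner.
  by move=> h y; rewrite pE.
rewrite /laplacian (eq_bigr _ (fun k _ => D2E k)).
rewrite exchange_big big1 // => -[[|n] lt_nd] _.
  (* Row 0 consists of ones, so its derivatives vanish. *)
  by apply: big1 => k _; rewrite expr0 derivnC horner0 mulr0.
(* Row [n.+1] differentiates to a multiple of row [n]; pairing row [n] with the cofactors of row
   [n.+1] gives an off-diagonal entry of [V x *m \adj (V x)], hence zero. *)
pose m := Ordinal (ltnW lt_nd).
have /matrixP/(_ m (Ordinal lt_nd)) adj0 := mul_mx_adj (V x).
rewrite !mxE -val_eqE ltn_eqF //= in adj0.
move/(congr1 (fun s => - (s *+ (n.*2.+2 * n.*2.+1)))): adj0.
rewrite mulr0n mul0rn oppr0; apply: etrans.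
rewrite -sumrMnl -sumrN; apply: eq_bigr => k _.
rewrite derivn2_expNX2 hornerN hornerMn horner_exp hornerN hornerXn !mxE.
by rewrite mulrN mulrnAr mulrC.
Qed.
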